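(* Let $1\le \ell\le d$ and $m_1,\dots,m_d$ be positive integers, and let $G$ be the $\ell$-cylindrical grid $Q^{\ell}_{2m_1,\dots,2m_d}=C_{2m_1}\square\cdots\square C_{2m_\ell}\square P_{2m_{\ell+1}}\square\cdots\square P_{2m_d}$, with vertex set $\prod_{i=1}^d[2m_i]$, carrying the boustrophedon labelling, and let $\mathcal{O}$ direct every edge from its lower-labelled to its higher-labelled endpoint. Give every vertex weight $x$ and every edge along the $q$-th coordinate direction weight $a_q$. Then the partition function of the monopole-dimer (loop-vertex) model on $(G,\mathcal{O})$ is $$\prod_{i_1=1}^{m_1}\cdots\prod_{i_d=1}^{m_d}\Big(x^2+\sum_{s=1}^{\ell}4a_s^2\sin^2\frac{(2i_s-1)\pi}{2m_s}+\sum_{t=\ell+1}^{d}4a_t^2\cos^2\frac{i_t\pi}{2m_t+1}\Big)^{2^{d-1}}.$$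
   Context: $P_n$ is the path on vertices $1,\dots,n$ and $C_n$ the cycle on $1,\dots,n$ (with the extra edge $\{1,n\}$). The Cartesian product $G_1\square\cdots\square G_k$ has vertex set $V(G_1)\times\cdots\times V(G_k)$, two vertices being adjacent iff they differ in exactly one coordinate $i$ and those $i$-th coordinates are adjacent in $G_i$; such an edge is ''along the $i$-th coordinate direction''. Boustrophedon labelling of a grid with side lengths $n_1,\dots,n_d$: for $d=1$ vertex $p$ gets label $p$; for $d>1$, with $N=n_1\cdots n_{d-1}$ and $L_{d-1}$ the labelling of the $(d-1)$-dimensional grid, vertex $(v_1,\dots,v_d)$ gets label $(v_d-1)N+L_{d-1}(v_1,\dots,v_{d-1})$ if $v_d$ is odd and $(v_d-1)N+N+1-L_{d-1}(v_1,\dots,v_{d-1})$ if $v_d$ is even. Loop-vertex (monopole-dimer) model on an oriented graph $(G,\mathcal{O})$ with vertex weights $x(v)$ and edge weights $a_{v,v'}=a_{v',v}$: $\mathrm{sgn}(v,v')=1$ if $v\to v'$ in $\mathcal{O}$ and $-1$ if $v'\to v$. A configuration is a collection of vertex-disjoint directed cycles of even length $\ge4$ (the two directions of a cycle giving different configurations), doubled edges (loops of length 2), and isolated vertices, such that every vertex lies in exactly one loop or is isolated. A loop $(v_0,\dots,v_{2k}=v_0)$ has weight $-\prod_{i=0}^{2k-1}\mathrm{sgn}(v_i,v_{i+1})a_{v_i,v_{i+1}}$ (a doubled edge $\{u,v\}$ has weight $a_{u,v}^2$); a configuration has weight the product of its loop weights and of $x(v)$ over isolated vertices. The partition function is the sum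 of the weights of all configurations.
   Formalization: When m_s = 1 for some s ≤ ℓ, the cycle C_2 is taken to have two parallel edges whose weights add, so that the vertex pair has weight 2a_s; with a single edge of weight a_s the formula fails (d = ℓ = m_1 = 1 gives x²+a², not x²+4a²). *)

(* Defs.v *)
From mathcomp Require Import all_boot all_order all_algebra all_fingroup.
From mathcomp Require Import reals trigo.

Set Implicit Arguments.
Unset Strict Implicit.
Unset Printing Implicit Defensive.

Import Order.TTheory GRing.Theory Num.Theory.
Local Open Scope ring_scope.

(* [o v w] means v -> w; only meaningful when v and w are adjacent. *)
Definition osgn (R : realType) (V : finType) (o : rel V) (v w : V) : R :=
  if o v w then 1 else -1.

(* A collection of vertex-disjoint directed loops covering the non-isolated
   vertices is encoded by the permutation sending every vertex to its successor
   on its loop: the cycles of the permutation are the loops, its 2-cycles are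
   the doubled edges and its fixed points are the isolated vertices. *)
Definition lv_config (V : finType) (adj : rel V) (s : {perm V}) : bool :=
  [forall v, (s v == v) || adj v (s v)] &&
  [forall C in porbits s, (#|C| == 1)%N || ~~ odd #|C|].

Definition loop_weight (R : realType) (V : finType) (o : rel V)
    (a : V -> V -> R) (s : {perm V}) (C : {set V}) : R :=
  - \prod_(v in C) (osgn R o v (s v) * a v (s v)).

Definition lv_weight (R : realType) (V : finType) (o : rel V)
    (x : V -> R) (a : V -> V -> R) (s : {perm V}) : R :=
  (\prod_(C in porbits s | (1 < #|C|)%N) loop_weight o a s C) *
  \prod_(v | s v == v) x v.

Definition lv_partition (R : realType) (V : finType) (adj o : rel V)
    (x : V -> R) (a : V -> V -> R) : R :=
  \sum_(s : {perm V} | lv_config adj s) lv_weight o x a s.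

(* A graph on V is given by [g : V -> V -> nat], where [g v w] is the number of
   edges joining v and w; vertex i of P_n and C_n is the ordinal i - 1. *)
Definition path_graph (n : nat) (i j : 'I_n) : nat :=
  ((i.+1 == j :> nat) || (j.+1 == i :> nat)).

(* P_n with the extra edge {1, n}.  The graph is simple for n > 2, but C_2 has
   two parallel edges joining its vertices. *)
Definition cycle_graph (n : nat) (i j : 'I_n) : nat :=
  (path_graph i j +
   (((i == 0 :> nat) && (j == n.-1 :> nat)) ||
    ((j == 0 :> nat) && (i == n.-1 :> nat))))%N.

(* Number of edges along the coordinate direction q in the Cartesian product. *)
Definition prod_edges (I : finType) (T : I -> finType)
    (g : forall i, T i -> T i -> nat) (q : I)
    (v w : {dffun forall i, T i}) : nat :=
  if [forall r, (r != q) ==> (v r == w r)] then g q (v q) (w q) else 0%N.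

Definition prod_adj (I : finType) (T : I -> finType)
    (g : forall i, T i -> T i -> nat) : rel {dffun forall i, T i} :=
  fun v w => [exists q, (0 < prod_edges g q v w)%N].

(* Every edge along direction q has weight [a q]; the weights of parallel edges
   (which only occur along a C_2 factor) add up. *)
Definition prod_weight (R : realType) (I : finType) (T : I -> finType)
    (g : forall i, T i -> T i -> nat) (a : I -> R)
    (v w : {dffun forall i, T i}) : R :=
  \sum_q a q *+ prod_edges g q v w.

Definition vertex (d : nat) (n : 'I_d -> nat) : finType :=
  {dffun forall q : 'I_d, 'I_(n q)}.

Definition cyl_grid (d l : nat) (n : 'I_d -> nat) (q : 'I_d) :
    'I_(n q) -> 'I_(n q) -> nat :=
  if (q < l)%N then @cycle_graph (n q) else @path_graph (n q).

(* Here the coordinates p of a vertex are numbered from 1.  Starting from the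
   one-vertex grid of dimension 0, the recursion gives label p in dimension 1. *)
Fixpoint boustrophedon (d : nat) :
    ('I_d -> nat) -> ('I_d -> nat) -> nat :=
  match d with
  | 0 => fun _ _ => 1%N
  | d'.+1 => fun n p =>
      let w := widen_ord (leqnSn d') in
      let N := (\prod_(i < d') n (w i))%N in
      let L := boustrophedon (n \o w) (p \o w) in
      if odd (p ord_max) then ((p ord_max).-1 * N + L)%N
      else ((p ord_max).-1 * N + N + 1 - L)%N
  end.

Definition label (d : nat) (n : 'I_d -> nat) (v : vertex n) : nat :=
  boustrophedon n (fun q => (v q).+1).

Definition label_orientation (d : nat) (n : 'I_d -> nat) : rel (vertex n) :=
  fun v w => (label v < label w)%N.

(* Main.v *)
Require Import Defs.
From mathcomp Require Import all_boot all_order all_algebra all_fingroup.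
From mathcomp Require Import reals trigo.
From mathcomp Require Import ring zify.

(* The grid is bipartite, so a permutation whose moved points follow edges has
   only fixed points and even cycles, and the partition function is
   det(x + K) for the signed weighted adjacency matrix K.  Reversing the
   labelling on every other slice makes K = sum_q a_q K_q, where
   K_q = 1 (x) .. (x) 1 (x) B_q (x) D (x) .. (x) D with B_q the signed adjacency
   matrix of the q-th factor and D = diag(1, -1, 1, ..).  Since B_q and D
   anticommute, so do the K_q, and K^2 = sum_q a_q^2 (.. 1 (x) B_q^2 (x) 1 ..).
   The real symmetric matrices B_q^2 are diagonalised by a sine basis (paths) or
   a cosine-plus-sine basis (cycles; the edge {1, n} points upwards, so B_q is
   antiperiodic).  As K is skew-symmetric,
   det(x + K)^2 = det(x + K) det(x - K) = det(x^2 - K^2), which is the square of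
   the claimed product, and two monic polynomials in x with the same square are
   equal. *)

Set Implicit Arguments.
Unset Strict Implicit.
Unset Printing Implicit Defensive.

Import Order.TTheory GRing.Theory Num.Theory.
Local Open Scope ring_scope.

(** * Matrices indexed by finite types and tensor products *)

(** Dependent functions correspond bijectively to [fprod], where all factors live in one tagged type
    and the non-dependent distributivity applies. *)
Lemma bigA_distr_dffun (R : comPzRingType) (I : finType) (T : I -> finType)
    (F : forall i, T i -> R) :
  \prod_i \sum_j F i j = \sum_(f : {dffun forall i, T i}) \prod_i F i (f i).
Proof.
rewrite (reindex (@dffun_of_fprod _ T))  /=;
  last exact/onW_bij/dffun_of_fprod_bij.
transitivity (\sum_(t : fprod T) \prod_(i in I) [ffun j => F i j] (t i)).
  rewrite big_fprod -(bigA_distr_big_dep (tagged_with T)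
    (fun i u => untag 0 [ffun j => F i j] u)).
  apply: eq_bigr => i _; rewrite -(big_tag (fun i => [ffun j => F i j])).
  by apply: eq_bigr => j _; rewrite ffunE.
by apply: eq_bigr => t _; apply: eq_bigr => i _; rewrite !ffunE.
Qed.

Section IndexedMatrix.
Variables (R : comPzRingType) (V : finType).

Definition vmx (F : V -> V -> R) : 'M[R]_#|V| :=
  \matrix_(i, j) F (enum_val i) (enum_val j).

Lemma vmxM F G :
  vmx F *m vmx G = vmx (fun v w => \sum_u F v u * G u w).
Proof.
apply/matrixP => i j; rewrite !mxE [RHS](reindex (@enum_val V predT)) /=.
  by apply: eq_bigr => k _; rewrite !mxE.
by apply: onW_bij; exact: enum_val_bij.
Qed.

Lemma eq_vmx F G : F =2 G -> vmx F = vmx G.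
Proof. by move=> FG; apply/matrixP => i j; rewrite !mxE FG. Qed.

(** Transport along [enum_rank] is a bijection onto the permutations of ['I_#|V|]. It preserves
    orbits, hence signs, so the Leibniz sums match term by term. *)
Lemma det_vmx F :
  \det (vmx F) = \sum_(s : {perm V}) (-1) ^+ s * \prod_v F v (s v).
Proof.
pose h (s : {perm V}) (i : 'I_#|V|) := enum_rank (s (enum_val i)).
have h_inj s : injective (h s).
  by move=> i j /enum_rank_inj/perm_inj/enum_val_inj.
pose h' (s : 'S_#|V|) (v : V) : V := enum_val (s (enum_rank v)).
have h'_inj s : injective (h' s).
  by move=> v w /enum_val_inj/perm_inj/enum_rank_inj.
pose H s := perm (@h_inj s).
have H_bij : bijective H.
  exists (fun s => perm (@h'_inj s)) => s; apply/permP => i;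
    by rewrite permE /h' /h permE /h /h' ?enum_valK ?enum_rankK.
have H_orbit s v : porbit (H s) (enum_rank v) = enum_rank @: porbit s v.
  have HX k u : iter k (H s) (enum_rank u) = enum_rank (iter k s u).
    by elim: k => //= k ->; rewrite permE /h enum_rankK.
  apply/setP => i; apply/porbitP/imsetP => [[k ->]|[w /porbitP[k ->] ->]].
    by exists ((s ^+ k)%g v); rewrite ?mem_porbit // !permX HX.
  by exists k; rewrite !permX HX.
(* The parity of a permutation is that of the number of points plus the number of orbits. *)
have H_odd s : odd_perm (H s) = odd_perm s.
  rewrite /odd_perm card_ord; congr (_ (+) odd _).
  have -> : porbits (H s) = (fun C : {set V} => enum_rank @: C) @: porbits s.
    apply/setP => C; apply/imsetP/imsetP => [[i _ ->]|[D /imsetP[v _ ->] ->]].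
      exists (porbit s (enum_val i)); first exact: imset_f.
      by rewrite -H_orbit enum_valK.
    by exists (enum_rank v).
  by rewrite card_imset //; exact/imset_inj/enum_rank_inj.
rewrite /determinant (reindex H) /=; last exact: onW_bij.
apply: eq_bigr => s _; rewrite H_odd; congr (_ * _).
rewrite [RHS](reindex (@enum_val V predT)) /=; last exact/onW_bij/enum_val_bij.
by apply: eq_bigr => i _; rewrite mxE permE /h enum_rankK.
Qed.

End IndexedMatrix.

Section TensorMatrix.
Variables (R : comPzRingType) (I : finType) (n : I -> nat).
Local Notation V := {dffun forall q : I, 'I_(n q)}.

(** The Kronecker product of the family [M]; rows and columns are indexed by dependent functions, so
    no order of the factors has to be fixed. *)
Definition tensmx (M : forall q, 'M[R]_(n q)) : 'M[R]_#|{: V}| :=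
  vmx (fun v w : V => \prod_q M q (v q) (w q)).

Lemma eq_tensmx M N : (forall q, M q = N q) -> tensmx M = tensmx N.
Proof.
by move=> MN; apply: eq_vmx => v w; apply: eq_bigr => q _; rewrite MN.
Qed.

Lemma tensmxM M N : tensmx M *m tensmx N = tensmx (fun q => M q *m N q).
Proof.
rewrite /tensmx vmxM; apply: eq_vmx => v w.
under [RHS]eq_bigr do rewrite mxE.
rewrite bigA_distr_dffun; apply: eq_bigr => u _.
by rewrite big_split.
Qed.

Lemma tensmx_scale (c : I -> R) M :
  tensmx (fun q => c q *: M q) = (\prod_q c q) *: tensmx M.
Proof.
apply/matrixP => i j; rewrite !mxE.
by under eq_bigr do rewrite mxE; rewrite big_split.
Qed.

Lemma tensmx_diag (f : forall q, 'I_(n q) -> R) :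
  tensmx (fun q => diag_mx (\row_j f q j)) =
  diag_mx (\row_i \prod_q f q ((enum_val i : V) q)).
Proof.
apply/matrixP => i j; rewrite !mxE.
have [<-|ij] := eqVneq i j.
  by rewrite mulr1n; apply: eq_bigr => q _; rewrite !mxE eqxx.
have [q vq] : exists q, (enum_val i : V) q != (enum_val j : V) q.
  apply/existsP; apply: contraR ij; rewrite negb_exists => /forallP vw.
  by apply/eqP/enum_val_inj/ffunP => q; move: (vw q) => /negbNE/eqP.
by rewrite (bigD1 q) //= !mxE (negPf vq) mul0r.
Qed.

Lemma tensmx1 : tensmx (fun q => 1%:M) = 1%:M.
Proof.
rewrite (@eq_tensmx _ (fun q => diag_mx (\row_j 1))) => [|q].
  rewrite tensmx_diag; apply/matrixP => i j; rewrite !mxE.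
  by rewrite big1_eq.
by apply/matrixP => i j; rewrite !mxE.
Qed.

Lemma tensmx_tr M : (tensmx M)^T = tensmx (fun q => (M q)^T).
Proof.
by apply/matrixP => i j; rewrite !mxE; apply: eq_bigr => q _; rewrite mxE.
Qed.

End TensorMatrix.

(** The cross terms cancel in pairs. The induction runs over a duplicate-free list, so the head
    index differs from all the others. *)
Lemma sum_anticomm_sq (R : pzRingType) (k : nat) (I : finType)
    (X : I -> 'M[R]_k) :
    (forall q r, q != r -> X q *m X r = - (X r *m X q)) ->
  (\sum_q X q) *m (\sum_q X q) = \sum_q X q *m X q.
Proof.
move=> anti; elim: index_enum (index_enum_uniq I) => [_|q s IHs /andP[qs us]].
  by rewrite !big_nil mul0mx.
rewrite !big_cons mulmxDl !mulmxDr IHs //.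
have -> : X q *m (\sum_(j <- s) X j) = - ((\sum_(j <- s) X j) *m X q).
  rewrite mulmx_sumr mulmx_suml -sumrN; apply: eq_big_seq => r rs.
  by rewrite anti //; apply: contraNneq qs => ->.
by rewrite -addrA; congr (_ + _); rewrite addKr.
Qed.

(** * The matrix K and its determinant *)

Section BoustrophedonMatrix.
Variables (R : comUnitRingType) (d : nat) (n : 'I_d -> nat).
Local Notation V := {dffun forall q : 'I_d, 'I_(n q)}.
Variables (B D U W : forall q, 'M[R]_(n q)) (c : forall q, 'I_(n q) -> R).
Variables (a : 'I_d -> R).

(** The factors [D] at the later coordinates record the reversal of every other slice. This is the
    pattern of the Jordan-Wigner transform. *)
Definition bmx_coord (q : 'I_d) : 'M[R]_#|{: V}| :=
  tensmx (fun r => if r == q then B r else if (q < r)%N then D r else 1%:M).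

Definition bmx : 'M[R]_#|{: V}| := \sum_q a q *: bmx_coord q.

Hypothesis D_sq : forall q, D q *m D q = 1%:M.
Hypothesis BD_anti : forall q, B q *m D q = - (D q *m B q).

(** For q < r, slot r is the only one whose factors fail to commute: there [D] meets [B]. Slot q
    pairs [B] with the identity. *)
Lemma bmx_coord_anti q r : q != r ->
  bmx_coord q *m bmx_coord r = - (bmx_coord r *m bmx_coord q).
Proof.
rewrite !tensmxM -scaleN1r.
wlog qr : q r / (q < r)%N => [hw|_].
  rewrite neq_ltn => /orP[qr|rq]; first by apply: hw => //; rewrite neq_ltn qr.
  by rewrite [in RHS]hw ?neq_ltn ?rq // scalerA mulrNN mulr1 scale1r.
(* The sign is put into slot r alone, which reduces the claim to one about each factor. *)
have -> : -1 = \prod_s (if s == r then -1 else 1) :> R.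
  by rewrite -big_mkcond big_pred1_eq.
rewrite -tensmx_scale; apply: eq_tensmx => s.
have [->|sr] := eqVneq s r.
  by rewrite gt_eqF // qr scaleN1r BD_anti opprK.
rewrite scale1r; have [->|sq] := eqVneq s q.
  by rewrite ltnNge ltnW //= mulmx1 mul1mx.
by do 2!case: ifP => _ //; rewrite ?mulmx1 ?mul1mx.
Qed.

Lemma bmx_coord_sq q : bmx_coord q *m bmx_coord q =
  tensmx (fun r => if r == q then B r *m B r else 1%:M).
Proof.
rewrite tensmxM; apply: eq_tensmx => r.
by case: ifP => // _; case: ifP => _; rewrite ?mulmx1.
Qed.

Lemma bmx_sq : bmx *m bmx =
  \sum_q a q ^+ 2 *: tensmx (fun r => if r == q then B r *m B r else 1%:M).
Proof.
rewrite sum_anticomm_sq => [|q r qr].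
  by apply: eq_bigr => q _; rewrite -scalemxAl -scalemxAr scalerA bmx_coord_sq.
rewrite -!scalemxAl -!scalemxAr !scalerA bmx_coord_anti //.
by rewrite scalerN [a q * _]mulrC.
Qed.

Hypothesis UW : forall q, U q *m W q = 1%:M.
Hypothesis UBBW : forall q,
  U q *m (B q *m B q) *m W q = diag_mx (\row_j - c j).

(** The left side is the determinant of [x^2 - K^2]. All terms of [K^2] become diagonal at once
    under the tensor products of the [U q] and the [W q]. *)
Lemma det_bmx x : \det (x%:M + bmx) * \det (x%:M - bmx) =
  \prod_(v : V) (x ^+ 2 + \sum_q a q ^+ 2 * c (v q)).
Proof.
rewrite -det_mulmx mulmxDl !mulmxBr !mul_scalar_mx mul_mx_scalar bmx_sq.
rewrite addrA subrK scale_scalar_mx.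
set K2 := (X in _ - X).
have TUW : tensmx U *m tensmx W = 1%:M.
  by rewrite tensmxM -[RHS]tensmx1; apply: eq_tensmx.
have -> : \det ((x * x)%:M - K2) =
    \det (tensmx U *m ((x * x)%:M - K2) *m tensmx W).
  by rewrite !det_mulmx mulrAC -det_mulmx TUW det1 mul1r.
have -> : tensmx U *m ((x * x)%:M - K2) *m tensmx W =
    diag_mx (\row_i (x ^+ 2 + \sum_q a q ^+ 2 * c ((enum_val i : V) q))).
  rewrite mulmxBr mulmxBl mul_mx_scalar -scalemxAl TUW.
  have -> : tensmx U *m K2 *m tensmx W =
      \sum_q a q ^+ 2 *: diag_mx (\row_i - c ((enum_val i : V) q)).
    rewrite mulmx_sumr mulmx_suml; apply: eq_bigr => q _.
    rewrite -scalemxAr -scalemxAl !tensmxM; congr (_ *: _).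
    (* Outside slot q the product [U r *m W r] is the identity, written here as a diagonal of
       ones. *)
    rewrite (@eq_tensmx _ _ _ _
        (fun r => diag_mx (\row_j if r == q then - c j else 1))) => [|r].
      rewrite tensmx_diag; congr diag_mx; apply/rowP => i; rewrite !mxE.
      rewrite (bigD1 q) //= eqxx big1 ?mulr1 // => r rq.
      by rewrite (negPf rq).
    case: eqP => _; first exact: UBBW.
    by rewrite mulmx1 UW; apply/matrixP => i j; rewrite !mxE.
  apply/matrixP => i j; rewrite !mxE summxE.
  have [<-|ij] := eqVneq i j.
    rewrite !mulr1n mulr1 -expr2 -sumrN; congr (_ + _); apply: eq_bigr => q _.
    by rewrite !mxE eqxx mulr1n mulrN opprK.
  rewrite !mulr0n mulr0 big1 ?subr0 // => q _.
  by rewrite !mxE (negPf ij) mulr0n mulr0.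
rewrite det_diag [RHS](reindex (@enum_val V predT)) /=.
  by apply: eq_bigr => i _; rewrite !mxE.
exact/onW_bij/enum_val_bij.
Qed.

Hypothesis B_tr : forall q, (B q)^T = - B q.
Hypothesis D_tr : forall q, (D q)^T = D q.

Lemma bmx_tr : bmx^T = - bmx.
Proof.
rewrite /bmx linear_sum -sumrN; apply: eq_bigr => q _.
rewrite linearZ /= tensmx_tr -scalerN; congr (_ *: _).
rewrite -scaleN1r.
have -> : -1 = \prod_s (if s == q then -1 else 1) :> R.
  by rewrite -big_mkcond big_pred1_eq.
rewrite -tensmx_scale; apply: eq_tensmx => r.
case: eqP => [->|_]; first by rewrite scaleN1r B_tr.
by rewrite scale1r; case: ifP; rewrite ?trmx1.
Qed.

(** K is skew-symmetric, so [x - K] is the transpose of [x + K] and the two determinants of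
    [det_bmx] agree. *)
Lemma det_bmx_sq x : \det (x%:M + bmx) ^+ 2 =
  \prod_(v : V) (x ^+ 2 + \sum_q a q ^+ 2 * c (v q)).
Proof.
rewrite -det_bmx expr2 -[in X in _ * X]det_tr linearD /= tr_scalar_mx.
by rewrite bmx_tr.
Qed.

End BoustrophedonMatrix.

(** * Recovering a monic polynomial from its square *)

Lemma monic_sqr_inj (R : numDomainType) (p q : {poly R}) :
  p \is monic -> q \is monic -> (forall x, p.[x] ^+ 2 = q.[x] ^+ 2) -> p = q.
Proof.
move=> /monicP mp /monicP mq pq.
have /eqP : (p - q) * (p + q) = 0.
  set r := _ * _.
  (* In characteristic zero the naturals give as many distinct roots as the size of [r], which
     forces [r = 0]. *)
  pose s : seq R := [seq i%:R | i <- iota 0 (size r)].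
  apply: (@roots_geq_poly_eq0 _ _ s); last by rewrite size_map size_iota.
    apply/allP => x _; rewrite /r -subr_sqr /root !hornerE /= pq.
    by rewrite subrr.
  rewrite map_inj_uniq ?iota_uniq // => i j /eqP.
  by rewrite eqr_nat => /eqP.
rewrite mulf_eq0 subr_eq0 addr_eq0 => /orP[/eqP //|/eqP pNq].
move: mp; rewrite pNq lead_coefN mq => /eqP.
by rewrite eq_sym -subr_eq0 opprK (pnatr_eq0 R 2).
Qed.

(** As a function of [y], [\det (y%:M + K)] is the characteristic polynomial of [- K], which is
    monic. *)
Lemma det_scalar_addmx (R : numDomainType) (k : nat) (K : 'M[R]_k)
    (Q : {poly R}) (x : R) :
    Q \is monic -> (forall y, \det (y%:M + K) ^+ 2 = Q.[y] ^+ 2) ->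
  \det (x%:M + K) = Q.[x].
Proof.
move=> mQ KQ.
have pE y : (char_poly (- K)).[y] = \det (y%:M + K).
  rewrite -horner_evalE -det_map_mx; congr (\det _); apply/matrixP => i j.
  rewrite !mxE /= /horner_eval.
  by rewrite hornerD hornerN !hornerE opprK hornerMn hornerX.
rewrite -pE; congr _.[x]; apply: monic_sqr_inj => // [|y].
  exact: char_poly_monic.
by rewrite pE.
Qed.

(** * The partition function as a determinant *)

Lemma prod_porbits (R : comPzRingType) (V : finType) (s : {perm V})
    (F : V -> R) :
  \prod_v F v = \prod_(C in porbits s) \prod_(v in C) F v.
Proof.
rewrite (partition_big (porbit s) (mem (porbits s))) /= => [|v _].
  apply: eq_bigr => C /imsetP[u _ ->]; apply: eq_bigl => v.
  by rewrite eq_porbit_mem porbit_sym.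
exact: imset_f.
Qed.

Lemma porbit_card1 (V : finType) (s : {perm V}) v :
  (#|porbit s v| == 1%N) = (s v == v).
Proof.
apply/eqP/eqP => [/eqP/cards1P[u Cu]|sv].
  have := mem_porbit s 1 v; have := porbit_id s v; rewrite Cu !inE expg1.
  by move=> /eqP-> /eqP.
have -> : porbit s v = [set v].
  apply/setP => u; rewrite inE; apply/porbitP/eqP => [[k ->]|->].
    by rewrite permX; elim: k => //= k ->.
  by exists 0; rewrite expg0 perm1.
by rewrite cards1.
Qed.

Section LoopVertexDeterminant.
Variables (R : realType) (V : finType) (adj o : rel V) (color : V -> bool).
Variables (x : R) (a : V -> V -> R).
Hypothesis adj_color : forall v w, adj v w -> color w = ~~ color v.
Hypothesis a_adj : forall v w, ~~ adj v w -> a v w = 0.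

(** Colours alternate along a nontrivial orbit, so returning to the start after a full turn forces
    an even length. *)
Lemma lv_configE (s : {perm V}) :
  lv_config adj s = [forall v, (s v == v) || adj v (s v)].
Proof.
rewrite /lv_config; case: forallP => //= hs.
apply/'forall_implyP => _ /imsetP[v _ ->].
rewrite porbit_card1; case: eqP => //= sv.
have h k : s (iter k s v) <> iter k s v /\
    color (iter k s v) = color v (+) odd k.
  elim: k => [|k [sk ck]]; first by rewrite /= addbF.
  split=> /= [/perm_inj//|].
  have /orP[/eqP//|/adj_color ->] := hs (iter k s v).
  by rewrite ck addbN.
have [_] := h #|porbit s v|.
by rewrite iter_porbit; case: (color v); case: odd.
Qed.

(** The Leibniz expansion is matched permutation by permutation. One that moves a vertex to a
    non-neighbour contributes 0; otherwise each even cycle has sign -1, which is the minus sign of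
    its loop weight. *)
Lemma lv_partition_det : lv_partition adj o (fun=> x) a =
  \det (vmx (fun v w => x *+ (v == w) + osgn R o v w * a v w)).
Proof.
have a0 v : a v v = 0.
  by apply: a_adj; apply/negP => /adj_color; case: (color v).
rewrite det_vmx /lv_partition big_mkcond /=; apply: eq_bigr => s _.
case: ifPn => [|]; last first.
  rewrite lv_configE negb_forall => /existsP[v].
  rewrite negb_or => /andP[sv av].
  rewrite (bigD1 v) //= eq_sym (negPf sv) a_adj //.
  by rewrite mulr0n mulr0 addr0 mul0r mulr0.
move=> /andP[_ /'forall_implyP hC]; rewrite /lv_weight.
(* An orbit [C] contributes [(-1) ^+ (#|C| + 1)] to the sign: 1 for a fixed point, -1 for an even
   cycle. *)
have -> : (-1) ^+ s = \prod_(C in porbits s | (1 < #|C|)%N) (-1) :> R.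
  rewrite /odd_perm -signr_odd oddb signr_addb !signr_odd.
  have -> : (-1) ^+ #|porbits s| = \prod_(C in porbits s) (-1) :> R.
    by rewrite prodr_const.
  have -> : (-1) ^+ #|V| = \prod_(C in porbits s) (-1) ^+ #|C| :> R.
    rewrite -[LHS](prodr_const V) (prod_porbits s).
    by apply: eq_bigr => C _; rewrite prodr_const.
  rewrite -big_split big_mkcondr; apply: eq_bigr => C hCs.
  rewrite /= -signr_odd; case: (ltngtP 1 #|C|) => [C1|C1|<-].
  - have /orP[/eqP C1'|/negPf->] := hC C hCs; last by rewrite expr0 mul1r.
    by rewrite C1' in C1.
  - move/imsetP: hCs C1 => [v _ ->].
    rewrite ltnS leqn0 cards_eq0 => /eqP h.
    by have := porbit_id s v; rewrite h inE.
  - by rewrite expr1 mulrNN mulr1.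
(* Fixed points give exactly [x], since [a v v = 0]; the other vertices are regrouped by orbits. *)
rewrite [in RHS](bigID (fun v => s v == v)) /= [in RHS]mulrCA mulrC.
congr (_ * _).
  by apply: eq_bigr => v /eqP sv; rewrite sv eqxx a0 mulr0 addr0.
under [X in _ = _ * X]eq_bigr => v sv.
  rewrite eq_sym (negPf sv) mulr0n add0r.
  over.
rewrite [X in _ * X]big_mkcond (prod_porbits s) /= [in RHS]big_mkcondr.
rewrite [in LHS]big_mkcondr -big_split; apply: eq_bigr => _ /imsetP[u _ ->] /=.
have sC v : v \in porbit s u -> (s v == v) = (#|porbit s u| == 1%N).
  by rewrite -eq_porbit_mem => /eqP<-; rewrite porbit_card1.
case: ifPn => C1.
  rewrite /loop_weight mulN1r; congr (- _); apply: eq_bigr => v vC.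
  by rewrite sC // gtn_eqF.
rewrite mul1r big1 // => v vC; rewrite sC //.
case: eqP => // C0; case/negP: C1; rewrite ltn_neqAle eq_sym; apply/andP.
split; first exact/eqP.
by rewrite card_gt0; apply/set0Pn; exists u; exact: porbit_id.
Qed.
End LoopVertexDeterminant.

(** * Boustrophedon labels *)

(** These bounds keep each slice in its own block of labels and make the truncated subtraction on
    reversed slices exact. *)
Lemma boustrophedon_bounds d (n p : 'I_d -> nat) :
    (forall q, 0 < p q <= n q)%N ->
  (0 < boustrophedon n p <= \prod_q n q)%N.
Proof.
elim: d n p => [|d IHd] n p hp; first by rewrite big_ord0.
rewrite big_ord_recr /=; set w := widen_ord _.
have := IHd (n \o w) (p \o w) (fun q => hp (w q)); rewrite /=.
move: (boustrophedon _ _) (\prod_(i < d) _)%N (hp ord_max) => L N.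
by case: ifP => _ ? ?; nia.
Qed.

(** Every later coordinate with an even value reverses the order once. These are the r with
    [(p r).-1] odd, so the sum has the parity of the number of reversals. *)
Lemma boustrophedon_lt d (n p p' : 'I_d -> nat) (q : 'I_d) :
    (forall r, 0 < p r <= n r)%N -> (forall r, 0 < p' r <= n r)%N ->
    (forall r, r != q -> p r = p' r) -> (p q < p' q)%N ->
  if odd (\sum_(r < d | (q < r)%N) (p r).-1)
  then (boustrophedon n p' < boustrophedon n p)%N
  else (boustrophedon n p < boustrophedon n p')%N.
Proof.
elim: d n p p' q => [|d IHd] n p p' q hp hp' pp' pq; first by case: q pp' pq.
rewrite big_mkcond big_ord_recr -big_mkcond /=; set w := widen_ord _.
have hL : (0 < boustrophedon (n \o w) (p \o w) <= \prod_(i < d) n (w i))%N.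
  by apply: boustrophedon_bounds => r; exact: hp.
have hL' : (0 < boustrophedon (n \o w) (p' \o w) <= \prod_(i < d) n (w i))%N.
  by apply: boustrophedon_bounds => r; exact: hp'.
have := hp ord_max; have := hp' ord_max.
case: (unliftP ord_max q) pq pp' => [q0|] -> pq pp'; last first.
  (* Here q is the last coordinate: the two labels lie in different blocks, and the bounds
     decide. *)
  rewrite ltnn addn0 [X in odd X]big_pred0 => [|r]; last first.
    by rewrite ltnNge ltnW //= ltn_ord.
  move: (boustrophedon _ _) (boustrophedon _ _) (\prod_(i < d) _)%N hL hL'.
  rewrite -(subnKC pq) addSn; case: (p ord_max) (p' ord_max - _)%N => [//|k] e.
  by move=> L L' N /= hL hL' _ _; do 2!case: ifP => _; nia.
(* Here both points lie in one slice, which keeps or reverses the lower-dimensional order by the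
   parity of [p ord_max]. *)
have wl r : w r = lift ord_max r by apply/val_inj/esym/lift_max.
have IH := IHd (n \o w) (p \o w) (p' \o w) q0
  (fun r => hp (w r)) (fun r => hp' (w r)).
rewrite -pp' ?neq_lift // lift_max ltn_ord oddD.
have {}IH : if odd (\sum_(r < d | (q0 < r)%N) (p (w r)).-1)
    then (boustrophedon (n \o w) (p' \o w) < boustrophedon (n \o w) (p \o w))%N
    else (boustrophedon (n \o w) (p \o w) < boustrophedon (n \o w) (p' \o w))%N.
  apply: IH => [r rq /=|]; last by rewrite /= !wl.
  by rewrite !wl pp' // (inj_eq lift_inj).
move: (boustrophedon _ _) (boustrophedon _ _) (\prod_(i < d) _)%N
  (\sum_(i < d | _) _)%N hL hL' IH => L L' N S.
by case: (odd S); case: (p ord_max) => [|k] //=; case: (odd k) => /=; nia.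
Qed.

Lemma label_lt d (n : 'I_d -> nat) (v w : vertex n) q :
    (forall r, r != q -> v r = w r) -> (v q < w q)%N ->
  if odd (\sum_(r < d | (q < r)%N) v r)
  then (label w < label v)%N else (label v < label w)%N.
Proof.
move=> vw qq.
apply: (@boustrophedon_lt d n (fun r => (v r).+1) (fun r => (w r).+1) q)
  => // [r|r|r rq]; rewrite ?ltn_ord //.
by rewrite vw.
Qed.

(** This is the sign of an entry of K_q: a one-dimensional sign at q times diagonal signs at the
    later coordinates. Ordinals count from 0, so the reversing values are the odd ones. *)
Lemma osgn_label (R : realType) d (n : 'I_d -> nat) (v w : vertex n) q :
    (forall r, r != q -> v r = w r) -> v q != w q ->
  osgn R (@label_orientation d n) v w =
  (if (v q < w q)%N then 1 else -1) *
  \prod_(r < d | (q < r)%N) (-1) ^+ (v r : nat).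
Proof.
move=> vw; rewrite neq_ltn /osgn /label_orientation prodrXr -signr_odd.
have S_eq : (\sum_(r < d | (q < r)%N) w r = \sum_(r < d | (q < r)%N) v r)%N.
  by apply: eq_bigr => r qr; rewrite vw // -(inj_eq val_inj) gtn_eqF.
case/orP=> [qq|/[dup] qq /ltnW].
  have := label_lt vw qq; rewrite qq mul1r.
  by case: odd => [/ltnW|->] //; rewrite leqNgt => /negPf ->.
rewrite leqNgt => /negPf ->.
have := label_lt (fun r rq => esym (vw r rq)) qq; rewrite S_eq.
by case: odd => [->|/ltnW]; rewrite ?mulrNN ?mulr1 // leqNgt => /negPf ->.
Qed.

(** * Signed adjacency matrices of paths and cycles *)

Section TrigSums.
Variable R : realType.
Implicit Types (b : R) (k t N : nat).

Lemma sin_natpi k : sin (k%:R * pi) = 0 :> R.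
Proof.
elim: k => [|k IHk]; first by rewrite mul0r sin0.
by rewrite -natr1 mulrDl mul1r sinDpi IHk oppr0.
Qed.

Lemma cos_natpi k : cos (k%:R * pi) = (-1) ^+ k :> R.
Proof.
elim: k => [|k IHk]; first by rewrite mul0r cos0.
by rewrite -natr1 mulrDl mul1r cosDpi IHk exprS mulN1r.
Qed.

(** Telescoping: [2 sin b cos (2jb) = sin ((2j+1)b) - sin ((2j-1)b)]. No division by [sin b] is
    made, so [b] is arbitrary. *)
Lemma sum_cos b k : (\sum_(j < k) cos (b *+ 2 * j%:R)) * (sin b *+ 2) =
  sin (b *+ 2 * k%:R - b) + sin b.
Proof.
elim: k => [|k IHk]; first by rewrite big_ord0 mulr0 sub0r sinN mul0r addNr.
rewrite big_ord_recr /= mulrDl IHk.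
have -> : b *+ 2 * k.+1%:R - b = b *+ 2 * k%:R + b by rewrite -natr1; ring.
by rewrite sinB sinD; ring.
Qed.

Lemma sum_sin b k : (\sum_(j < k) sin (b *+ 2 * j%:R)) * (sin b *+ 2) =
  cos b - cos (b *+ 2 * k%:R - b).
Proof.
elim: k => [|k IHk]; first by rewrite big_ord0 mulr0 sub0r cosN mul0r subrr.
rewrite big_ord_recr /= mulrDl IHk.
have -> : b *+ 2 * k.+1%:R - b = b *+ 2 * k%:R + b by rewrite -natr1; ring.
by rewrite cosB cosD; ring.
Qed.

Lemma sin_frac_gt0 t N : (0 < t < N)%N -> 0 < sin (t%:R * pi / N%:R) :> R.
Proof.
move=> /andP[t0 tN]; have N0 : (0 : R) < N%:R by rewrite ltr0n (ltn_trans t0).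
have t0' : (0 : R) < t%:R by rewrite ltr0n.
apply: sin_gt0_pi; rewrite divr_gt0 ?mulr_gt0 ?pi_gt0 //=.
by rewrite ltr_pdivrMr // mulrC ltr_pM2l ?pi_gt0 // ltr_nat.
Qed.

(** With b = t pi / 2N the telescoped sum is [(1 - (-1)^t) sin b], and the bounds on [t] make
    [sin b] nonzero. *)
Lemma sum_cos_half_period t N : (0 < t < N.*2)%N ->
  \sum_(j < N) cos (t%:R * pi / N%:R * j%:R) = (odd t)%:R :> R.
Proof.
move=> tN; have N0 : N%:R != 0 :> R by rewrite pnatr_eq0; lia.
pose b : R := t%:R * pi / (N.*2)%:R.
have b2 : b *+ 2 = t%:R * pi / N%:R.
  by rewrite /b -muln2 natrM; field.
have sb : sin b != 0 by rewrite gt_eqF // sin_frac_gt0.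
have s2 : sin b *+ 2 != 0 by rewrite mulrn_eq0.
apply: (mulIf s2); rewrite -b2 sum_cos b2 divfK // sinB sin_natpi cos_natpi.
by rewrite -signr_odd; case: odd; rewrite /=; ring.
Qed.

Lemma sum_cos_period t N : (0 < t < N)%N ->
  \sum_(j < N) cos ((t%:R * pi / N%:R) *+ 2 * j%:R) = 0 :> R.
Proof.
move=> tN; have N0 : N%:R != 0 :> R by rewrite pnatr_eq0; lia.
have s0 : sin (t%:R * pi / N%:R) *+ 2 != 0 :> R.
  by rewrite mulrn_eq0 /= gt_eqF // sin_frac_gt0.
apply: (mulIf s0); rewrite sum_cos.
have -> : (t%:R * pi / N%:R) *+ 2 * N%:R = (t%:R * pi) *+ 2 :> R by field.
rewrite sinB.
rewrite sin_mulr2n cos_mulr2n sin_natpi cos_natpi sqrr_sign; ring.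
Qed.

Lemma sum_sin_period t N : (0 < N)%N ->
  \sum_(j < N) sin ((t%:R * pi / N%:R) *+ 2 * j%:R) = 0 :> R.
Proof.
move=> N_gt0; have N0 : N%:R != 0 :> R by rewrite pnatr_eq0 -lt0n.
(* If the sine vanishes, for instance when N divides t, then every term of the sum is 0. *)
have [s0|s0] := eqVneq (sin (t%:R * pi / N%:R) : R) 0.
  rewrite big1 // => j _; move: (t%:R * pi / N%:R) s0 => b s0.
  elim: (j : nat) => [|k IHk]; first by rewrite mulr0 sin0.
  rewrite -natr1 mulrDr mulr1 sinD IHk sin_mulr2n s0.
  by rewrite mulr0 mul0rn mul0r mulr0 addr0.
have s2 : sin (t%:R * pi / N%:R) *+ 2 != 0 :> R by rewrite mulrn_eq0.
apply: (mulIf s2); rewrite sum_sin.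
have -> : (t%:R * pi / N%:R) *+ 2 * N%:R = (t%:R * pi) *+ 2 :> R by field.
rewrite cosB.
rewrite sin_mulr2n cos_mulr2n sin_natpi cos_natpi sqrr_sign; ring.
Qed.

End TrigSums.

(** * Diagonalising the squared one-dimensional matrices *)

Section OneDimension.
Variable R : realType.

Definition signed_adj n (g : 'I_n -> 'I_n -> nat) : 'M[R]_n :=
  \matrix_(i, j) ((if (i < j)%N then 1 else -1) * (g i j)%:R).

Definition alt_mx n : 'M[R]_n := diag_mx (\row_j (-1) ^+ (j : nat)).

Lemma signed_adj_tr n (g : 'I_n -> 'I_n -> nat) :
    (forall i j, g i j = g j i) -> (forall i, g i i = 0%N) ->
  (signed_adj g)^T = - signed_adj g.
Proof.
move=> gC g0; apply/matrixP => i j; rewrite !mxE gC.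
case: (ltngtP i j) => [ij|ij|/val_inj->]; rewrite ?mulN1r ?mul1r ?opprK //.
by rewrite g0 oppr0.
Qed.

Lemma alt_mx_sq n : alt_mx n *m alt_mx n = 1%:M.
Proof.
rewrite mulmx_diag -diag_const_mx; congr diag_mx; apply/rowP => j.
by rewrite !mxE -expr2 sqrr_sign.
Qed.

(** The ends of an edge have opposite parity, so [alt_mx] has opposite signs there. *)
Lemma signed_adj_alt n (g : 'I_n -> 'I_n -> nat) :
    (forall i j, (0 < g i j)%N -> odd j = ~~ odd i) ->
  signed_adj g *m alt_mx n = - (alt_mx n *m signed_adj g).
Proof.
move=> godd; apply/matrixP => i j.
rewrite mul_mx_diag mul_diag_mx !mxE.
have [->|] := posnP (g i j); first by rewrite !mulr0 mul0r oppr0.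
move=> /godd oj; rewrite -[in LHS]signr_odd oj -[in RHS]signr_odd signrN.
by rewrite mulrN mulrC.
Qed.

Lemma path_graphC n (i j : 'I_n) : path_graph i j = path_graph j i.
Proof. by rewrite /path_graph orbC. Qed.

Lemma cycle_graphC n (i j : 'I_n) : cycle_graph i j = cycle_graph j i.
Proof. by rewrite /cycle_graph path_graphC [in RHS]orbC. Qed.

Lemma path_graph_odd n (i j : 'I_n) :
  (0 < path_graph i j)%N -> odd j = ~~ odd i.
Proof. by rewrite /path_graph lt0b => /orP[] /eqP <-; rewrite /= ?negbK. Qed.

Lemma cycle_graph_odd n (i j : 'I_n) : ~~ odd n ->
  (0 < cycle_graph i j)%N -> odd j = ~~ odd i.
Proof.
move=> n_even; rewrite addn_gt0 => /orP[/path_graph_odd //|].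
have n1 : odd n.-1 by case: n i {j} n_even => [[]//|k _] /=; rewrite negbK.
by rewrite lt0b => /orP[] /andP[/eqP-> /eqP->]; rewrite n1.
Qed.

Lemma sum_delta N (u : nat -> R) j : (j < N)%N ->
  \sum_(p < N) u p * (p == j :> nat)%:R = u j.
Proof.
move=> jN; rewrite (bigD1 (Ordinal jN)) //= eqxx mulr1 big1 ?addr0 // => p.
by rewrite -(inj_eq val_inj) /= => /negPf->; rewrite mulr0.
Qed.

(** Column j has 1 in row j - 1 and -1 in row j + 1. Positions in [u] count from 1, and the last two
    terms remove the values at the virtual positions 0 and n + 1. *)
Lemma path_adj_shift n (u : nat -> R) (j : 'I_n) :
  \sum_(i < n) u i.+1 * signed_adj (@path_graph n) i j =
  u j - u j.+2 - u 0 * (j == 0 :> nat)%:R + u n.+1 * (j == n.-1 :> nat)%:R.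
Proof.
transitivity (\sum_(i < n) u i.+1 * (i.+1 == j :> nat)%:R
              - \sum_(i < n) u i.+1 * (i == j.+1 :> nat)%:R).
  rewrite -sumrB; apply: eq_bigr => i _; rewrite mxE -mulrBr; congr (_ * _).
  rewrite /path_graph [in RHS](eq_sym _ j.+1).
  have [ij|ij] := ltnP i j.
    have -> : (j.+1 == i :> nat) = false by lia.
    by rewrite orbF mul1r subr0.
  have -> : (i.+1 == j :> nat) = false by lia.
  by rewrite orFb mulN1r sub0r.
have jn := ltn_ord j.
(* Each sum is extended by one virtual position, where [sum_delta] applies, and the extra term is
   taken off again. *)
have := sum_delta u (ltnW jn : (j < n.+1)%N).
rewrite big_ord_recl /= => /(canRL (addKr _)) ->.
have := sum_delta (fun p => u p.+1) (jn : (j.+1 < n.+1)%N).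
rewrite big_ord_recr /= => /(canRL (addrK _)) ->.
have -> : (n == j.+1) = (j == n.-1 :> nat) by lia.
rewrite eq_sym; ring.
Qed.

(** The upward edge from the first to the last vertex supplies exactly the boundary terms of an
    antiperiodic sequence. For n = 2 its entries add to those of the parallel path edge. *)
Lemma cycle_adj_shift n (u : nat -> R) (j : 'I_n) : (1 < n)%N ->
    u 0 = - u n -> u n.+1 = - u 1 ->
  \sum_(i < n) u i.+1 * signed_adj (@cycle_graph n) i j = u j - u j.+2.
Proof.
move=> n1 u0 un.
have n0 : (0 < n)%N by apply: ltnW.
have nn : (n.-1 < n)%N by rewrite prednK.
transitivity (\sum_(i < n) u i.+1 * signed_adj (@path_graph n) i j
  + \sum_(i < n) u i.+1 * (i == 0 :> nat)%:R * (j == n.-1 :> nat)%:R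
  - \sum_(i < n) u i.+1 * (i == n.-1 :> nat)%:R * (j == 0 :> nat)%:R).
  rewrite -big_split -sumrB; apply: eq_bigr => i _ /=.
  rewrite -!mulrA -mulrDr -mulrBr !mxE /cycle_graph natrD mulrDr -addrA.
  congr (_ * (_ + _)); have [ij|ij] := ltnP i j.
    have -> : (j == 0 :> nat) = false by lia.
    by rewrite mulr0 subr0 mul1r orbF -natrM mulnb.
  have corner0 : (i == 0 :> nat) && (j == n.-1 :> nat) = false by lia.
  rewrite corner0.
  have -> : (i == 0 :> nat)%:R * (j == n.-1 :> nat)%:R = 0 :> R.
    by rewrite -natrM mulnb corner0.
  by rewrite mulN1r orFb sub0r -natrM mulnb andbC.
rewrite -!mulr_suml (sum_delta (fun p => u p.+1) n0).
rewrite (sum_delta (fun p => u p.+1) nn) path_adj_shift prednK // u0 un.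
ring.
Qed.

(** A real skew matrix need not have real eigenvectors. Instead [B] swaps two real families up to
    the factors [e] and [- e], so [B *m B] acts on [u] by [- e ^+ 2]; orthogonality of [u] gives the
    inverse [N^-1 *: U^T]. *)
Lemma signed_adj_diag n (B : 'M[R]_n) (u u' : 'I_n -> nat -> R)
    (e : 'I_n -> R) (N : R) :
    (forall k j : 'I_n, \sum_(i < n) u k i.+1 * B i j = e k * u' k j.+1) ->
    (forall k j : 'I_n, \sum_(i < n) u' k i.+1 * B i j = - e k * u k j.+1) ->
    N != 0 ->
    (forall k l : 'I_n, \sum_(j < n) u k j.+1 * u l j.+1 = N *+ (k == l)) ->
  exists U W : 'M[R]_n, U *m W = 1%:M /\
    U *m (B *m B) *m W = diag_mx (\row_k - e k ^+ 2).
Proof.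
move=> uB u'B N0 uu.
pose U := \matrix_(k < n, j < n) u k j.+1.
pose U' := \matrix_(k < n, j < n) u' k j.+1.
have UB : U *m B = diag_mx (\row_k e k) *m U'.
  apply/matrixP => k j; rewrite mul_diag_mx !mxE -uB.
  by apply: eq_bigr => i _; rewrite mxE.
have U'B : U' *m B = diag_mx (\row_k - e k) *m U.
  apply/matrixP => k j; rewrite mul_diag_mx !mxE -u'B.
  by apply: eq_bigr => i _; rewrite mxE.
have UUT : U *m (N^-1 *: U^T) = 1%:M.
  apply/matrixP => k l; rewrite -scalemxAr !mxE.
  under eq_bigr do rewrite !mxE.
  by rewrite uu mulrnAr mulVf.
exists U, (N^-1 *: U^T); split=> //.
have -> : U *m (B *m B) = diag_mx (\row_k - e k ^+ 2) *m U.
  rewrite mulmxA UB -mulmxA U'B mulmxA mulmx_diag; congr (diag_mx _ *m _).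
  by apply/rowP => k; rewrite !mxE mulrN expr2.
by rewrite -mulmxA UUT mulmx1.
Qed.

(** The sine waves vanish at positions 0 and n + 1, so the boundary terms of [path_adj_shift] drop
    out. *)
Lemma path_adj_diag m : (0 < m)%N ->
  exists U W : 'M[R]_(2 * m), U *m W = 1%:M /\
    U *m (signed_adj (@path_graph _) *m signed_adj (@path_graph _)) *m W =
    diag_mx (\row_k
      - (4 * cos ((k : nat).+1%:R * pi / (2 * m%:R + 1)) ^+ 2)).
Proof.
move=> m0; pose n := (2 * m)%N.
have N0 : n.+1%:R != 0 :> R by rewrite pnatr_eq0.
have -> : 2 * m%:R + 1 = n.+1%:R :> R by rewrite -[n.+1%:R]natr1 /n natrM.
pose al (k : 'I_n) : R := k.+1%:R * pi / n.+1%:R.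
(* These signs, changing every two positions, turn the difference in [path_adj_shift] into a sum of
   sines. *)
pose s (p : nat) : R := (-1) ^+ p./2.
have sS p : s p.+2 = - s p by rewrite /s /= exprS mulN1r.
pose u k p := s p * sin (al k * p%:R).
pose u' k p := s p.+1 * sin (al k * p%:R).
have u0 k q : s q * sin (al k * 0%:R) = 0 by rewrite mulr0 sin0 mulr0.
have un k q : s q * sin (al k * n.+1%:R) = 0.
  by rewrite /al divfK // sin_natpi mulr0.
have sin2 k p :
  sin (al k * p%:R) + sin (al k * p.+2%:R) =
    2 * cos (al k) * sin (al k * p.+1%:R).
  have -> : al k * p%:R = al k * p.+1%:R - al k by rewrite -natr1; ring.
  have -> : al k * p.+2%:R = al k * p.+1%:R + al k.
    by rewrite -(natr1 p.+1); ring.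
  by rewrite sinB sinD; ring.
have [k j|k j||k l|U [W [UW UBW]]] := @signed_adj_diag n
    (signed_adj (@path_graph _)) u u' (fun k => - (2 * cos (al k)))
    (n.+1%:R / 2).
- rewrite path_adj_shift /u u0 un !mul0r subr0 addr0 /u' sS.
  by rewrite (mulNr (s j)) opprK -mulrDr sin2; ring.
- rewrite path_adj_shift /u' u0 un !mul0r subr0 addr0 /u !sS.
  by rewrite (mulNr (s j.+1)) opprK -mulrDr sin2; ring.
- by rewrite mulf_neq0 // invr_eq0 pnatr_eq0.
- pose F k l p : R := sin (al k * p%:R) * sin (al l * p%:R).
  have -> : \sum_(j < n) u k j.+1 * u l j.+1 = \sum_(j < n.+1) F k l j.
    rewrite big_ord_recl {1}/F mulr0 sin0 mul0r add0r; apply: eq_bigr => j _.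
    by rewrite /u mulrACA -expr2 sqrr_sign mul1r.
  wlog kl : k l / (l <= k)%N => [hw|].
    case/orP: (leq_total l k) => [/hw //|/hw]; rewrite eq_sym => <-.
    by apply: eq_bigr => j _; rewrite /F mulrC.
  (* The numbers k - l and k + l + 2 have the same parity, so for k different from l the two cosine
     sums cancel. *)
  have -> : \sum_(j < n.+1) F k l j =
     ((\sum_(j < n.+1) cos ((k - l)%:R * pi / n.+1%:R * j%:R)) -
     (\sum_(j < n.+1) cos ((k.+1 + l.+1)%:R * pi / n.+1%:R * j%:R))) / 2.
    rewrite -sumrB mulr_suml; apply: eq_bigr => j _; rewrite /F.
    have -> : (k - l)%:R * pi / n.+1%:R * j%:R =
        al k * j%:R - al l * j%:R :> R.
      by rewrite natrB // /al -!natr1; ring.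
    have -> : (k.+1 + l.+1)%:R * pi / n.+1%:R * j%:R =
        al k * j%:R + al l * j%:R :> R.
      by rewrite natrD /al; ring.
    by rewrite cosB cosD; field.
  rewrite (@sum_cos_half_period _ (k.+1 + l.+1)); last first.
    by have := ltn_ord k; have := ltn_ord l; rewrite -/n; lia.
  have [->|kNl] := eqVneq k l.
    rewrite subnn; under eq_bigr do rewrite !mul0r cos0.
    by rewrite sumr_const card_ord addnn odd_double subr0.
  rewrite sum_cos_half_period; last first.
    have : k != l :> nat by [].
    by have := ltn_ord k; rewrite -/n; lia.
  rewrite oddB // oddD /= addbN addNb negbK.
  by rewrite subrr mul0r.
exists U, W; split=> //; rewrite UBW; congr diag_mx; apply/rowP => k.
by rewrite !mxE /al; ring.
Qed.

Lemma cycle_adj_diag m : (0 < m)%N ->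
  exists U W : 'M[R]_(2 * m), U *m W = 1%:M /\
    U *m (signed_adj (@cycle_graph _) *m signed_adj (@cycle_graph _)) *m W =
    diag_mx (\row_k
      - (4 * sin ((2 * (k : nat).+1%:R - 1) * pi / (2 * m%:R)) ^+ 2)).
Proof.
move=> m0; pose n := (2 * m)%N.
have n_gt0 : (0 < n)%N by rewrite /n; lia.
have N0 : n%:R != 0 :> R by rewrite pnatr_eq0 -lt0n.
have -> : 2 * m%:R = n%:R :> R by rewrite /n natrM.
pose al (k : 'I_n) : R := (2 * k.+1%:R - 1) * pi / n%:R.
(* Since [n * al k] is an odd multiple of pi, both families are antiperiodic. The sum cos + sin (the
   Hartley kernel) separates k from n - 1 - k, whose cosines coincide and whose sines are
   opposite. *)
pose u k p := cos (al k * p%:R) + sin (al k * p%:R).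
pose u' k p := cos (al k * p%:R) - sin (al k * p%:R).
have alE k p : al k * (n + p)%:R = ((2 * k)%:R * pi + al k * p%:R) + pi.
  by rewrite natrD natrM /al -natr1; field.
have cosn k p : cos (al k * (n + p)%:R) = - cos (al k * p%:R).
  rewrite alE cosDpi cosD sin_natpi cos_natpi -signr_odd oddM /=.
  by rewrite mul1r mul0r subr0.
have sinn k p : sin (al k * (n + p)%:R) = - sin (al k * p%:R).
  rewrite alE sinDpi sinD sin_natpi cos_natpi -signr_odd oddM /=.
  by rewrite mul1r mul0r add0r.
have un k p : u k (n + p)%N = - u k p by rewrite /u cosn sinn opprD.
have u'n k p : u' k (n + p)%N = - u' k p by rewrite /u' cosn sinn opprD.
have u0 k : u k 0 = - u k n.
  by have := un k 0; rewrite addn0 => ->; rewrite opprK.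
have u'0 k : u' k 0 = - u' k n.
  by have := u'n k 0; rewrite addn0 => ->; rewrite opprK.
have uS k : u k n.+1 = - u k 1 by rewrite -un addn1.
have u'S k : u' k n.+1 = - u' k 1 by rewrite -u'n addn1.
have n_gt1 : (1 < n)%N by rewrite /n; lia.
have alS k p : (al k * p%:R = al k * p.+1%:R - al k) *
    (al k * p.+2%:R = al k * p.+1%:R + al k).
  by split; rewrite -!natr1; ring.
have [k j|k j||k l|U [W [UW UBW]]] := @signed_adj_diag n
    (signed_adj (@cycle_graph _)) u u' (fun k => - (2 * sin (al k))) n%:R.
- rewrite cycle_adj_shift //.
  by rewrite /u /u' !(alS k j) cosB cosD sinB sinD; ring.
- rewrite cycle_adj_shift //.
  by rewrite /u /u' !(alS k j) cosB cosD sinB sinD; ring.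
- by [].
(* A product of two antiperiodic sequences is periodic, so the range 1..n may be shifted to
   0..n-1. *)
- have -> : \sum_(j < n) u k j.+1 * u l j.+1 = \sum_(j < n) u k j * u l j.
    apply: (addrI (u k 0 * u l 0)).
    have := big_ord_recl n (fun j : 'I_n.+1 => u k j * u l j) => /= <-.
    rewrite big_ord_recr /= addrC; congr (_ + _).
    by rewrite !u0 mulrNN.
  wlog kl : k l / (l <= k)%N => [hw|].
    case/orP: (leq_total l k) => [/hw //|/hw]; rewrite eq_sym => <-.
    by apply: eq_bigr => j _; rewrite mulrC.
  have -> : \sum_(j < n) u k j * u l j =
     (\sum_(j < n) cos (((k - l)%:R * pi / n%:R) *+ 2 * j%:R)) +
     (\sum_(j < n) sin (((k + l).+1%:R * pi / n%:R) *+ 2 * j%:R)).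
    rewrite -big_split; apply: eq_bigr => j _; rewrite /u /=.
    have -> : ((k - l)%:R * pi / n%:R) *+ 2 * j%:R =
        al k * j%:R - al l * j%:R :> R.
      by rewrite natrB // /al -!natr1; ring.
    have -> : ((k + l).+1%:R * pi / n%:R) *+ 2 * j%:R =
        al k * j%:R + al l * j%:R :> R.
      by rewrite -natr1 natrD /al -!natr1; ring.
    by rewrite cosB sinD; ring.
  rewrite sum_sin_period // addr0.
  have [->|kNl] := eqVneq k l.
    rewrite subnn; under eq_bigr do rewrite !mul0r mul0rn mul0r cos0.
    by rewrite sumr_const card_ord.
  rewrite sum_cos_period //.
  have : k != l :> nat by [].
  by have := ltn_ord k; rewrite -/n; lia.
exists U, W; split=> //; rewrite UBW; congr diag_mx; apply/rowP => k.
by rewrite !mxE /al; ring.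
Qed.

End OneDimension.

(** * Cylindrical grids *)

(** Factors are grouped by image; a fibre of the product map is a product of [#|I|] fibres of size
    [k]. *)
Lemma prod_dffun_fiber (R : comPzRingType) (I : finType) (T T' : I -> finType)
    (f : forall q, T q -> T' q) (k : nat) (F : {dffun forall q, T' q} -> R) :
    (forall q i, #|[pred j | f q j == i]| = k) ->
  \prod_(v : {dffun forall q, T q}) F [ffun q => f q (v q)] =
  \prod_i F i ^+ (k ^ #|I|).
Proof.
move=> fk; rewrite (partition_big (fun v : {dffun forall q, T q} =>
  [ffun q => f q (v q)] : {dffun forall q, T' q}) predT) //=.
apply: eq_bigr => i _; rewrite (eq_bigr (fun _ => F i)) => [|v /eqP<-] //.
rewrite prodr_const; congr (_ ^+ _).
transitivity #|(family (fun q => [pred j | f q j == i q]) :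
    simpl_pred {dffun forall q, T q})|.

  apply: eq_card => v.
  transitivity ([ffun q => f q (v q)] == i :> {dffun forall q, T' q}) => //.
  apply/eqP/familyP => [<- q|h]; first by rewrite inE ffunE.
  by apply/ffunP => q; rewrite ffunE; apply/eqP; have := h q; rewrite inE.
rewrite card_family cardE /image_mem.
by elim: (enum _) => //= q s ->; rewrite fk expnS.
Qed.

Section Grid.
Variable R : realType.

Definition axis_graph (b : bool) n : 'I_n -> 'I_n -> nat :=
  if b then @cycle_graph n else @path_graph n.

(** The negated eigenvalues of B_q^2, with [i] counted from 0; the same formula serves for all 2m
    eigenvalues and for the m factors of the theorem. *)
Definition axis_eigen (b : bool) (m i : nat) : R :=
  if b then 4 * sin ((2 * i.+1%:R - 1) * pi / (2 * m%:R)) ^+ 2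
  else 4 * cos (i.+1%:R * pi / (2 * m%:R + 1)) ^+ 2.

Lemma axis_graphC b n (i j : 'I_n) : axis_graph b i j = axis_graph b j i.
Proof. by case: b; [exact: cycle_graphC | exact: path_graphC]. Qed.

Lemma axis_graph_odd b m (i j : 'I_(2 * m)) :
  (0 < axis_graph b i j)%N -> odd j = ~~ odd i.
Proof.
case: b; last exact: path_graph_odd.
by apply: cycle_graph_odd; rewrite oddM.
Qed.

Lemma axis_graph_irrefl b m (i : 'I_(2 * m)) : axis_graph b i i = 0%N.
Proof.
by apply/eqP; rewrite -leqn0 leqNgt; apply/negP => /axis_graph_odd; case: odd.
Qed.

(** The eigenvalues come in equal pairs: on a cycle the angles of k and k + m differ by pi, on a
    path those of k and 2m - 1 - k add up to pi. *)
Lemma axis_fold b m : (0 < m)%N -> exists f : 'I_(2 * m) -> 'I_m,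
  (forall i, #|[pred k | f k == i]| = 2) /\
  (forall k : 'I_(2 * m), axis_eigen b m k = axis_eigen b m (f k)).
Proof.
case: m => // m _; pose g (k : nat) :=
  if (k < m.+1)%N then k else if b then (k - m.+1)%N else (2 * m.+1 - k.+1)%N.
have gm k : (k < 2 * m.+1)%N -> (g k < m.+1)%N.
  by rewrite /g; case: ifP => // km; case: (b); lia.
exists (fun k : 'I_(2 * m.+1) => Ordinal (gm k (ltn_ord k))); split=> [i|k].
  have i1 : (i < 2 * m.+1)%N by have := ltn_ord i; lia.
  have i2 : ((if b then i + m.+1 else 2 * m.+1 - i.+1) < 2 * m.+1)%N.
    by clear gm g; have := ltn_ord i; case: b; lia.
  rewrite (@eq_card _ _ (pred2 (Ordinal i1) (Ordinal i2))) => [|k].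
    rewrite card2 -(inj_eq val_inj) /=; have := ltn_ord i.
    by clear gm g i2; case: b; case: eqP => //=; lia.
  rewrite !inE -!(inj_eq val_inj) /= /g; have := ltn_ord i; have := ltn_ord k.
  by clear gm g i2; case: (ltnP k m.+1); case: b; lia.
rewrite /= /g; case: ltnP => // mk; rewrite /axis_eigen.
have m0 : m.+1%:R != 0 :> R by rewrite pnatr_eq0.
clear gm g; case: b.
  rewrite -{1}(subnK mk); set j := (k - _)%N.
  have -> : (2 * (j + m.+1).+1%:R - 1) * pi / (2 * m.+1%:R) =
      (2 * j.+1%:R - 1) * pi / (2 * m.+1%:R) + pi :> R.
    by rewrite -addSn natrD; field; rewrite nat1r.
  by rewrite sinDpi sqrrN.
have n0 : 2 * m.+1%:R + 1 != 0 :> R.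
  by rewrite -natrM -[1]/(1%:R) -natrD pnatr_eq0 addn1.
have -> : (2 * m.+1 - k.+1).+1%:R * pi / (2 * m.+1%:R + 1) =
    - (k.+1%:R * pi / (2 * m.+1%:R + 1)) + pi :> R.
  by rewrite -natr1 natrB // natrM; field; rewrite nat1r.
by rewrite cosDpi sqrrN cosN.
Qed.

Lemma axis_diag b m : (0 < m)%N ->
  exists (U W : 'M[R]_(2 * m)), U *m W = 1%:M /\
    U *m (signed_adj R (@axis_graph b _) *m signed_adj R (@axis_graph b _)) *m W
    = diag_mx (\row_k - axis_eigen b m k).
Proof. by case: b; [exact: cycle_adj_diag | exact: path_adj_diag]. Qed.

(** * The signed adjacency matrix of the grid *)

Section GridMatrix.
Variables (d l : nat) (m : 'I_d -> nat) (a : 'I_d -> R).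
Let n (q : 'I_d) := (2 * m q)%N.
Let G := cyl_grid l (n := n).

Definition grid_adj (q : 'I_d) : 'M[R]_(n q) :=
  signed_adj R (@axis_graph (q < l)%N (n q)).

Lemma cyl_gridE q : @G q = @axis_graph (q < l)%N (n q).
Proof. by []. Qed.

Lemma prod_edges_gt0 q (v w : vertex n) : (0 < prod_edges G q v w)%N ->
  (forall r, r != q -> v r = w r) /\
  (0 < @axis_graph (q < l)%N _ (v q) (w q))%N.
Proof.
rewrite /prod_edges; case: ifP => // /forallP vw.
rewrite cyl_gridE; split=> // r rq.
by apply/eqP; have := vw r; rewrite rq.
Qed.

Lemma prod_adj_odd (v w : vertex n) : prod_adj G v w ->
  odd (\sum_q w q) = ~~ odd (\sum_q v q).
Proof.
move=> /existsP[q /prod_edges_gt0[vw /axis_graph_odd vwq]].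
rewrite (bigD1 q) //= oddD vwq [in RHS](bigD1 q) //= oddD addNb.
congr (~~ (_ (+) odd _)).
by apply: eq_bigr => r rq; rewrite vw.
Qed.

Lemma prod_weight0 (v w : vertex n) :
  ~~ prod_adj G v w -> prod_weight G a v w = 0.
Proof.
rewrite negb_exists => /forallP vw; rewrite /prod_weight big1 // => q _.
by have := vw q; rewrite lt0n negbK => /eqP ->.
Qed.

Lemma osgn_prod_weight (v w : vertex n) :
  osgn R (@label_orientation d n) v w * prod_weight G a v w =
  \sum_q a q * \prod_r (if r == q then grid_adj r else
     if (q < r)%N then alt_mx R (n r) else 1%:M) (v r) (w r).
Proof.
rewrite /prod_weight mulr_sumr; apply: eq_bigr => q _.
rewrite /prod_edges; case: ifPn => [/forallP vw|]; last first.
  (* If v and w differ at some r other than q, no edge along q joins them, and the diagonal factor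
     in slot r vanishes too. *)
  rewrite negb_forall => /existsP[r]; rewrite negb_imply => /andP[rq vwr].
  rewrite mulr0n mulr0 (bigD1 r) //= (negPf rq).
  by case: ifP => _; rewrite !mxE (negPf vwr) mulr0n mul0r mulr0.
have {}vw r : r != q -> v r = w r.
  by move=> rq; apply/eqP; have := vw r; rewrite rq.
have -> : \prod_r (if r == q then grid_adj r else
     if (q < r)%N then alt_mx R (n r) else 1%:M) (v r) (w r) =
   grid_adj q (v q) (w q) * \prod_(r < d | (q < r)%N) (-1) ^+ (v r : nat).
  rewrite (bigD1 q) //= eqxx; congr (_ * _); rewrite [RHS]big_mkcond.
  rewrite [RHS](bigD1 q) //= ltnn mul1r; apply: eq_bigr => r rq.
  by rewrite (negPf rq) -vw //; case: ifP; rewrite !mxE eqxx.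
rewrite mxE cyl_gridE; have [vwq|vwq] := eqVneq (v q) (w q).
  by rewrite vwq axis_graph_irrefl !mulr0n !mulr0 mul0r mulr0.
rewrite (osgn_label _ vw vwq) -mulr_natr; ring.
Qed.

Lemma grid_matrixE x :
  vmx (fun v w : vertex n => x *+ (v == w) +
    osgn R (@label_orientation d n) v w * prod_weight G a v w) =
  x%:M + bmx grid_adj (fun q => alt_mx R (n q)) a.
Proof.
apply/matrixP => i j; rewrite !mxE summxE osgn_prod_weight.
rewrite (inj_eq enum_val_inj).
congr (_ + _); apply: eq_bigr => q _; rewrite !mxE; congr (_ * _).
Qed.

End GridMatrix.
End Grid.

Theorem theorem3p4 (R : realType) (d l : nat) (m : 'I_d -> nat)
    (x : R) (a : 'I_d -> R)
    (hl : (1 <= l <= d)%N) (hm : forall q, (0 < m q)%N) :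
  let n := fun q : 'I_d => (2 * m q)%N in
  let G := cyl_grid l (n := n) in
  lv_partition (prod_adj G) (@label_orientation d n)
    (fun _ => x) (prod_weight G a) =
  \prod_(i : {dffun forall q : 'I_d, 'I_(m q)})
    (x ^+ 2
     + \sum_(s < d | (s < l)%N)
         4 * a s ^+ 2 *
         sin ((2 * (i s).+1%:R - 1) * pi / (2 * (m s)%:R)) ^+ 2
     + \sum_(t < d | (l <= t)%N)
         4 * a t ^+ 2 *
         cos ((i t).+1%:R * pi / (2 * (m t)%:R + 1)) ^+ 2)
    ^+ (2 ^ d.-1)%N.
Proof.
move=> n G.
rewrite (@lv_partition_det _ _ _ _ (fun v : vertex n => odd (\sum_q v q)));
  [|exact: prod_adj_odd|exact: prod_weight0].
rewrite grid_matrixE.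
have := fun q : 'I_d => axis_diag R (q < l)%N (hm q).
move=> /fin_all_exists[U /fin_all_exists[W UW]].
have := fun q : 'I_d => axis_fold R (q < l)%N (hm q).
move=> /fin_all_exists[f fE].
pose C (i : {dffun forall q, 'I_(m q)}) : R :=
  \sum_q a q ^+ 2 * axis_eigen R (q < l)%N (m q) (i q).
(* The claimed product, seen as a monic polynomial in x. *)
pose Q : {poly R} := \prod_i ('X^2 + (C i)%:P) ^+ (2 ^ d.-1).
have QE y : Q.[y] = \prod_i (y ^+ 2 + C i) ^+ (2 ^ d.-1).
  by rewrite horner_prod; apply: eq_bigr => i _; rewrite !hornerE.
rewrite (@det_scalar_addmx _ _ _ Q) => [||y].
- rewrite QE; apply: eq_bigr => i _; congr (_ ^+ _).
  rewrite -addrA; congr (_ + _).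
  rewrite /C (bigID (fun q : 'I_d => (q < l)%N)) /=; congr (_ + _).
    by apply: eq_bigr => q ql; rewrite /axis_eigen ql; ring.
  apply: eq_big => [q|q ql]; first by rewrite -leqNgt.
  by rewrite /axis_eigen (negPf ql); ring.
- apply: monic_prod => i _; apply: monic_exp.
  rewrite monicE lead_coefDl ?lead_coefXn // size_polyXn size_polyC.
  by case: eqP.
rewrite (@det_bmx_sq R d n _ _ U W
  (fun q k => axis_eigen R (q < l)%N (m q) k)) => [|q|q|q|q|q|q].
(* Folding each axis two to one raises every factor to the power [2 ^ d], the square of the claimed
   power [2 ^ d.-1]; [hl] gives d > 0. *)
- rewrite QE -prodrXl.
  transitivity (\prod_(v : {dffun forall q, 'I_(n q)})
      (y ^+ 2 + C [ffun q => f q (v q)])).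
    apply: eq_bigr => v _; congr (_ + _); apply: eq_bigr => q _.
    by rewrite ffunE (fE q).2.
  rewrite (@prod_dffun_fiber _ _ _ _ _ 2 (fun i => y ^+ 2 + C i)) => [|q i].
    apply: eq_bigr => i _; rewrite -exprM card_ord -expnSr prednK //.
    by case/andP: hl => [/leq_trans]; apply.
  exact: (fE q).1.
- exact: alt_mx_sq.
- by apply: signed_adj_alt => i j; exact: axis_graph_odd.
- exact: (UW q).1.
- exact: (UW q).2.
- by apply: signed_adj_tr; [exact: axis_graphC | exact: axis_graph_irrefl].
- exact: tr_diag_mx.
Qed.
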